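(* Let $n\ge 1$ be an integer. Let $\mathcal X\subset\mathbb R^2$ be an $n$-independent set of nodes with $\#\mathcal X\le 2n+1$. Then each node of $\mathcal X$ has an $n$-fundamental polynomial (with respect to $\mathcal X$) which is a product of lines. Moreover, this statement is not true in general for larger sets: for every $n\ge 2$ and every integer $s$ with $2n+2\le s\le \binom{n+2}{2}$ there exist an $n$-independent set $\mathcal X\subset\mathbb R^2$ with $\#\mathcal X=s$ and a node $A\in\mathcal X$ such that no $n$-fundamental polynomial of $A$ with respect to $\mathcal X$ is a product of lines.
   Context: $\Pi_n$ denotes the space of real polynomials in two variables of total degree at most $n$; $\dim\Pi_n=\binom{n+2}{2}$. A set of nodes is a finite set $\mathcal X$ of distinct points of $\mathbb R^2$. For $A\in\mathcal X$, an $n$-fundamental polynomial of $A$ (with respect to $\mathcal X$) is a polynomial $p\in\Pi_n$ with $p(A)=1$ and $p(B)=0$ for all $B\in\mathcal X\setminus\{A\}$; a polynomial in $\Pi_n$ that vanishes on $\mathcal X\setminus\{A\}$ and is nonzero at $A$ is also called fundamental, being a nonzero constant multiple of such a $p$. The set $\mathcal X$ is $n$-independent if every node of $\mathcal X$ has an $n$-fundamental polynomial; this forces $\#\mathcal X\le\binom{n+2}{2}$. A line is identified with a real polynomial of degree $1$ defining it; ''a product of lines'' means a product of real polynomials of degree $1$, up to a nonzero constant factor. *)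

(* Defs.v *)
From mathcomp Require Import all_boot all_order all_algebra.
From mathcomp Require Import finmap reals.
From mathcomp Require Import mpoly.

Set Implicit Arguments.
Unset Strict Implicit.
Unset Printing Implicit Defensive.

Local Open Scope fset_scope.
Local Open Scope ring_scope.

(* [A 0] is the coordinate function ['I_2 -> R] of the row vector [A]. *)
Definition eval_at (R : realType) (p : {mpoly R[2]}) (A : 'rV[R]_2) : R :=
  p.@[A 0].

(* [msize p] is the total degree plus one, and [msize 0 = 0]. *)
Definition in_Pi (R : realType) (n : nat) (p : {mpoly R[2]}) : Prop :=
  (msize p <= n.+1)%N.

Definition is_line (R : realType) (l : {mpoly R[2]}) : Prop :=
  msize l = 2%N.

(* At least one factor is required, so that a constant is not a product of
   lines. *)
Definition is_product_of_lines (R : realType) (p : {mpoly R[2]}) : Prop :=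
  exists (c : R) (ls : seq {mpoly R[2]}),
    [/\ c != 0, ls != [::], (forall l, l \in ls -> is_line l)
      & p = c *: \prod_(l <- ls) l].

Definition fundamental (R : realType) (n : nat) (X : {fset 'rV[R]_2})
    (A : 'rV[R]_2) (p : {mpoly R[2]}) : Prop :=
  [/\ in_Pi n p, eval_at p A = 1
    & forall B, B \in X `\ A -> eval_at p B = 0].

Definition independent (R : realType) (n : nat) (X : {fset 'rV[R]_2}) : Prop :=
  forall A, A \in X -> exists p, fundamental n X A p.

(* Main.v *)
Require Import Defs.
From mathcomp Require Import all_boot all_order all_algebra.
From mathcomp Require Import finmap reals.
From mathcomp Require Import mpoly.
From mathcomp Require Import zify ring lra.

(** Small sets. Let [A] be a node and call two other nodes equivalent when
    they lie on the same line through [A]. A line through [A] contains at most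
    [n] of the other nodes: a fundamental polynomial of [A], restricted to that
    line, is a univariate polynomial of degree at most [n] which is nonzero at
    [A] and has these nodes as roots ([count_slope_le]). So the at most [2n]
    other nodes have no equivalence class of more than [n] elements, and they
    can be split into [n] groups of at most two inequivalent nodes: list them
    class by class and put the [i]-th with the [(i + n)]-th
    ([exists_perm_shift_neq]). Each group lies on a line that misses [A], and
    the product of these [n] lines is fundamental up to a constant
    ([exists_fundamental_product]).

    Large sets. Put [2n + 1] nodes on the parabola [y = x^2] and the remaining
    ones, [A] among them, off it. On the parabola, a polynomial of degree at
    most [n] becomes a univariate polynomial of degree at most [2n] in [x]. If
    it vanishes at the [2n + 1] nodes it vanishes on the whole parabola, and if
    it were a product of lines, one of the lines would contain the parabola,
    which is absurd ([product_of_lines_parabola_roots]).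

    It remains to choose the nodes so that they are independent. The parabola
    nodes are independent among themselves by the construction for small sets,
    because two chords of the parabola through one point have different slopes
    ([parabola_independent]). The other nodes form part of a triangular grid
    below the parabola which is [(n - 2)]-independent and has up to
    [binomial n 2 = binomial (n + 2) 2 - (2n + 1)] elements; multiplying its
    fundamental polynomials, which are products of grid lines, by the equation
    of the parabola makes them vanish at the parabola nodes as well.
    Subtracting multiples of these products then corrects the fundamental
    polynomials of the parabola nodes ([independent_extend]). *)

Set Implicit Arguments.
Unset Strict Implicit.
Unset Printing Implicit Defensive.

Import Order.TTheory GRing.Theory Num.Theory.

Local Open Scope fset_scope.
Local Open Scope ring_scope.

(** * Restricting a polynomial to a parametrized curve *)

Section Along.
Variables (R : idomainType) (k : nat).
Implicit Types (g : 'I_k -> {poly R}) (p : {mpoly R[k]}).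

Definition along g p : {poly R} := mmap (@polyC R) g p.

Lemma horner_along g p t : (along g p).[t] = p.@[fun i => (g i).[t]].
Proof.
rewrite /along /mmap mevalE horner_sum; apply: eq_bigr => m _.
rewrite hornerM hornerC; congr (_ * _).
by rewrite /mmap1 horner_prod; apply: eq_bigr => i _; rewrite horner_exp.
Qed.

Lemma along_scale_prod g (c : R) (ls : seq {mpoly R[k]}) :
  along g (c *: \prod_(l <- ls) l) = c%:P * \prod_(l <- ls) along g l.
Proof. by rewrite /along mmapZ rmorph_prod. Qed.

(** Along a curve of degree [d] the degree is multiplied by at most [d]: this
    is applied to lines ([d = 1]) and to the parabola ([d = 2]). *)
Lemma size_along g p d :
  (forall i, size (g i) <= d.+1)%N ->
  (size (along g p) <= (d * (msize p).-1).+1)%N.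
Proof.
move=> gd; rewrite /along /mmap big_seq.
apply: (big_ind (fun q : {poly R} => size q <= (d * (msize p).-1).+1)%N).
- by rewrite size_poly0.
- by move=> a b ha hb; apply: leq_trans (size_polyD _ _) _; rewrite geq_max ha.
move=> m mp; apply: leq_trans (_ : (d * mdeg m).+1 <= _)%N; last first.
  have lt_m := msize_mdeg_lt mp.
  by rewrite ltnS leq_mul // -ltnS (ltn_predK lt_m).
rewrite mul_polyC; apply: leq_trans (size_scale_leq _ _) _.
rewrite mdegE /mmap1.
apply: (big_ind2 (fun (q : {poly R}) e => size q <= (d * e).+1)%N).
- by rewrite size_poly1.
- move=> a e b f ha hb; apply: leq_trans (size_polyMleq _ _) _.
  by rewrite mulnDr -subn1 leq_subLR add1n -addnS -addSn leq_add.
move=> i _; apply: leq_trans (size_poly_exp_leq _ _) _.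
by rewrite ltnS leq_mul //; have := gd i; lia.
Qed.

End Along.

(** * Pairing elements with different keys *)

Section Pairing.
Variables (T K : eqType) (key : T -> K).

(** In a list arranged by blocks of equal keys, two elements at distance [n]
    with the same key would enclose [n + 1] elements with this key. *)
Lemma exists_perm_shift_neq (n : nat) (s : seq T) :
  (forall k, count (fun x => key x == k) s <= n)%N ->
  exists2 t, perm_eq t s & forall x0 i, (i + n < size t)%N ->
    key (nth x0 t i) != key (nth x0 t (i + n)).
Proof.
(* A mere [eqType] has no order to sort by, so keys are ranked by their first
   occurrence. *)
move=> bound; pose rank x := index (key x) (map key s).
pose t := sort (relpre rank leq) s.
have ts : perm_eq t s by rewrite perm_sort.
exists t => // x0 i lt_in; apply/negP => /eqP eqk.
have mono j l : (j <= l < size t)%N -> (rank (nth x0 t j) <= rank (nth x0 t l))%N.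
  case/andP=> jl lt_l; apply: (@sorted_leq_nth _ (relpre rank leq)) => //.
  - by move=> x y z /=; apply: leq_trans.
  - by move=> x /=.
  - by apply: sort_sorted => x y; apply: leq_total.
  - by rewrite inE; lia.
set k := key (nth x0 t i) in eqk.
have all_k : all (fun x => key x == k) (take n.+1 (drop i t)).
  apply/(all_nthP x0) => j; rewrite size_take size_drop => lt_j.
  have {}lt_j : (j < n.+1)%N by move: lt_j; case: ifP; lia.
  rewrite nth_take // nth_drop.
  have eq_rank : rank (nth x0 t (i + j)) = rank (nth x0 t i).
    have h1 := @mono i (i + j)%N; have h2 := @mono (i + j)%N (i + n)%N.
    have h3 : rank (nth x0 t (i + n)) = rank (nth x0 t i) by rewrite /rank -eqk.
    by apply/eqP; rewrite eqn_leq h1 ?andbT -?h3 ?h2 //; lia.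
  have memk l : (l < size t)%N -> key (nth x0 t l) \in map key s.
    by move=> lt_l; apply: map_f; rewrite -(perm_mem ts) mem_nth.
  by apply/eqP; apply: (@index_inj _ (key x0)) eq_rank; apply: memk; lia.
have := bound k; rewrite -(permP ts) leqNgt => /negP; apply.
rewrite -[t in count _ t](cat_take_drop i) -[drop i t](cat_take_drop n.+1).
move: all_k; rewrite !count_cat all_count => /eqP ->.
by rewrite size_take size_drop; case: ifP; lia.
Qed.

End Pairing.

(** * Points of the plane and the spaces of polynomials of bounded degree *)

Section Plane.
Variable R : realType.
Implicit Types (p q l : {mpoly R[2]}) (A B P Q : 'rV[R]_2) (X Z : {fset 'rV[R]_2}).

Definition pt (x y : R) : 'rV[R]_2 := \row_i (if i == 0 then x else y).

Lemma pt0 x y : pt x y 0 0 = x. Proof. by rewrite mxE. Qed.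
Lemma pt1 x y : pt x y 0 1 = y. Proof. by rewrite mxE. Qed.

Lemma rV2P A B : A 0 0 = B 0 0 -> A 0 1 = B 0 1 -> A = B.
Proof.
move=> e0 e1; apply/rowP; case=> [[|[|i]] hi] //.
  by rewrite (_ : Ordinal hi = 0) //; apply: val_inj.
by rewrite (_ : Ordinal hi = 1) //; apply: val_inj.
Qed.

Lemma eval_atM p q A : eval_at (p * q) A = eval_at p A * eval_at q A.
Proof. exact: mevalM. Qed.

Lemma eval_atZ c p A : eval_at (c *: p) A = c * eval_at p A.
Proof. exact: mevalZ. Qed.

Lemma eval_at_prod (ls : seq {mpoly R[2]}) A :
  eval_at (\prod_(l <- ls) l) A = \prod_(l <- ls) eval_at l A.
Proof. by rewrite /eval_at rmorph_prod. Qed.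

Definition eval_atE :=
  (mevalD, mevalB, mevalN, mevalM, mevalZ, mevalC, mevalXU, pt0, pt1).

Lemma in_PiW m n p : (m <= n)%N -> in_Pi m p -> in_Pi n p.
Proof. by rewrite /in_Pi => mn pm; apply: leq_trans pm _. Qed.

Lemma in_PiD n p q : in_Pi n p -> in_Pi n q -> in_Pi n (p + q).
Proof.
by rewrite /in_Pi => pn qn; apply: leq_trans (msizeD_le _ _) _; rewrite geq_max pn.
Qed.

Lemma in_PiZ n c p : in_Pi n p -> in_Pi n (c *: p).
Proof. by rewrite /in_Pi; apply: leq_trans (msizeZ_le _ _). Qed.

Lemma in_PiB n p q : in_Pi n p -> in_Pi n q -> in_Pi n (p - q).
Proof. by move=> pn qn; rewrite -scaleN1r; apply: in_PiD => //; apply: in_PiZ. Qed.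

Lemma in_PiM m n p q : in_Pi m p -> in_Pi n q -> in_Pi (m + n) (p * q).
Proof.
rewrite /in_Pi => pm qn.
have [->|p0] := eqVneq p 0; first by rewrite mul0r msize0.
have [->|q0] := eqVneq q 0; first by rewrite mulr0 msize0.
by rewrite msizeM // -subn1 leq_subLR add1n -addnS -addSn leq_add.
Qed.

Lemma in_PiC n (c : R) : in_Pi n c%:MP.
Proof. by rewrite /in_Pi msizeC; case: (c == 0). Qed.

Lemma in_PiX i : in_Pi 1 ('X_i : {mpoly R[2]}).
Proof. by rewrite /in_Pi msizeX mdeg1. Qed.

Lemma in_Pi_prod (ls : seq {mpoly R[2]}) :
  (forall l, l \in ls -> in_Pi 1 l) -> in_Pi (size ls) (\prod_(l <- ls) l).
Proof.
elim: ls => [|l ls IH] h; first by rewrite big_nil; apply: in_PiC.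
rewrite big_cons; apply: (@in_PiM 1); first by apply: h; rewrite mem_head.
by apply: IH => l' l'ls; apply: h; rewrite inE l'ls orbT.
Qed.

Lemma fundamental_scale n X A p :
  in_Pi n p -> eval_at p A != 0 ->
  (forall B, B \in X `\ A -> eval_at p B = 0) ->
  fundamental n X A ((eval_at p A)^-1 *: p).
Proof.
move=> pn pA pX; split; first exact: in_PiZ.
  by rewrite eval_atZ mulVf.
by move=> B BX; rewrite eval_atZ (pX B BX) mulr0.
Qed.

(** * Lines through a node *)

(** [None] stands for the vertical direction; [slope A A] is the dummy value
    [None] as well, and [A] itself is always excluded where this matters. *)
Definition slope A B : option R :=
  if B 0 0 == A 0 0 then None else Some ((B 0 1 - A 0 1) / (B 0 0 - A 0 0)).

(** The points counted lie on one line through [A]; the restriction of [p] to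
    it has degree at most [n], is not zero at [A], and has them as roots. *)
Lemma count_slope_le n p A (s : seq 'rV[R]_2) k :
  in_Pi n p -> eval_at p A != 0 -> uniq s ->
  (forall B, B \in s -> eval_at p B = 0) ->
  (count (fun B => slope A B == k) s <= n)%N.
Proof.
move=> pn pA us ps.
(* [d] directs the line of slope [k] through [A], and [par B] is the parameter
   of the point [B] of that line. *)
pose d : 'rV[R]_2 := if k is Some m then pt 1 m else pt 0 1.
pose par B := if k is Some _ then B 0 0 - A 0 0 else B 0 1 - A 0 1.
have parP B : slope A B == k -> B = A + par B *: d.
  rewrite /slope /par /d; case: ifPn => [/eqP e | ne] /eqP <-;
    apply: rV2P; rewrite !mxE /=.
  - by rewrite e; ring.
  - by ring.
  - by ring.
  - by field; rewrite subr_eq0.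
rewrite -size_filter; set s' := filter _ s.
pose g i : {poly R} := (A 0 i)%:P + d 0 i *: 'X.
have gE B : B \in s' -> (along g p).[par B] = eval_at p B.
  rewrite mem_filter => /andP[/parP eB _]; rewrite horner_along.
  apply: meval_eq => i; transitivity ((A + par B *: d) 0 i); last by rewrite -eB.
  by rewrite mxE [in RHS]mxE !hornerE mulrC.
have gA : (along g p).[0] = eval_at p A.
  by rewrite horner_along; apply: meval_eq => i; rewrite !hornerE.
have nz : along g p != 0 by apply: contraNneq pA => e; rewrite -gA e horner0.
have rt : all (root (along g p)) (map par s').
  apply/allP => _ /mapP[B Bs ->]; rewrite rootE gE // ps //.
  by move: Bs; rewrite mem_filter => /andP[].
have ut : uniq (map par s').
  rewrite map_inj_in_uniq ?filter_uniq // => B C; rewrite !mem_filter.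
  by move=> /andP[/parP eB _] /andP[/parP eC _] e; rewrite eB eC e.
rewrite -(size_map par) -ltnS; apply: leq_trans (max_poly_roots nz rt ut) _.
apply: leq_trans (size_along _ (d := 1) _) _ => [i|].
  apply: leq_trans (size_polyD _ _) _; rewrite geq_max size_polyC.
  rewrite (leq_trans (size_scale_leq _ _)) ?size_polyX ?andbT //.
  by case: (_ != 0).
by move: pn; rewrite /in_Pi mul1n; case: (msize p).
Qed.

(** * Products of lines avoiding a node *)

Definition line_at P (a b : R) : {mpoly R[2]} :=
  a *: ('X_0 - (P 0 0)%:MP) + b *: ('X_1 - (P 0 1)%:MP).

Lemma eval_line_at P a b B :
  eval_at (line_at P a b) B = a * (B 0 0 - P 0 0) + b * (B 0 1 - P 0 1).
Proof. by rewrite /eval_at /line_at !eval_atE. Qed.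

Lemma in_Pi_line_at P a b : in_Pi 1 (line_at P a b).
Proof.
by apply: in_PiD; apply: in_PiZ; apply: in_PiB; (apply: in_PiX || apply: in_PiC).
Qed.

(** Two different values exclude a constant, so the degree is exactly 1. *)
Lemma is_line_nonconst l A B :
  in_Pi 1 l -> eval_at l A != 0 -> eval_at l B = 0 -> is_line l.
Proof.
rewrite /in_Pi /is_line => l1 lA lB; apply/eqP; rewrite eqn_leq l1 ltnNge.
apply/negP => /msize1_polyC e; move: lA lB.
by rewrite /eval_at e !mevalC => /eqP.
Qed.

Lemma exists_line_avoiding A P Q :
  P != A -> P = Q \/ slope A P != slope A Q /\ Q != A ->
  exists l, [/\ is_line l, eval_at l A != 0, eval_at l P = 0 & eval_at l Q = 0].
Proof.
move=> PA PQ.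
suff [a [b [nz z]]] : exists a b,
    a * (A 0 0 - P 0 0) + b * (A 0 1 - P 0 1) != 0
    /\ a * (Q 0 0 - P 0 0) + b * (Q 0 1 - P 0 1) = 0.
  exists (line_at P a b); have lP : eval_at (line_at P a b) P = 0.
    by rewrite eval_line_at; ring.
  have lA : eval_at (line_at P a b) A != 0 by rewrite eval_line_at.
  split=> //; last by rewrite eval_line_at.
  exact: is_line_nonconst (in_Pi_line_at _ _ _) lA lP.
(* For [P = Q], the line through [P] orthogonal to [A - P]. *)
case: PQ => [<-|[neq QA]].
  exists (A 0 0 - P 0 0), (A 0 1 - P 0 1); split; last by ring.
  apply: contraNneq PA => /eqP.
  rewrite -!expr2 paddr_eq0 ?sqr_ge0 // !sqrf_eq0 !subr_eq0.
  by case/andP=> /eqP e0 /eqP e1; apply/eqP/rV2P.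
(* Otherwise the line [PQ]; its value at [A] is the determinant of [P - A] and
   [Q - A] up to sign, whose vanishing forces equal slopes. *)
exists (Q 0 1 - P 0 1), (P 0 0 - Q 0 0); split; last by ring.
apply: contraNneq neq => e; rewrite /slope.
have [P0|P0] := eqVneq (P 0 0) (A 0 0); have [Q0|Q0] := eqVneq (Q 0 0) (A 0 0) => //.
- have P1 : A 0 1 - P 0 1 != 0.
    apply: contraNneq PA => /eqP; rewrite subr_eq0 => /eqP P1.
    by apply/eqP/rV2P.
  have /eqP : (A 0 1 - P 0 1) * (Q 0 0 - A 0 0) = 0.
    by rewrite -[RHS]oppr0 -e P0; ring.
  by rewrite mulf_eq0 (negPf P1) subr_eq0 (negPf Q0).
- have Q1 : A 0 1 - Q 0 1 != 0.
    apply: contraNneq QA => /eqP; rewrite subr_eq0 => /eqP Q1.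
    by apply/eqP/rV2P.
  have /eqP : (A 0 1 - Q 0 1) * (P 0 0 - A 0 0) = 0.
    by rewrite -e Q0; ring.
  by rewrite mulf_eq0 (negPf Q1) subr_eq0 (negPf P0).
apply/eqP; congr Some; apply/eqP; rewrite eqr_div ?subr_eq0 //.
by rewrite -subr_eq0 -e; apply/eqP; ring.
Qed.

(** Element [i] of the list is put with element [i + n] on a line missing [A];
    as there are at most [2n] elements, [n] lines suffice. *)
Lemma exists_lines_covering n A (s : seq 'rV[R]_2) :
  (size s <= 2 * n)%N -> A \notin s ->
  (forall k, count (fun B => slope A B == k) s <= n)%N ->
  exists ls : seq {mpoly R[2]},
    [/\ size ls = n, forall l, l \in ls -> is_line l,
        forall l, l \in ls -> eval_at l A != 0
      & forall B, B \in s -> exists2 l, l \in ls & eval_at l B = 0].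
Proof.
move=> ss As /exists_perm_shift_neq[t ts tP].
have At B : B \in t -> B != A by rewrite (perm_mem ts); apply: contraTneq => ->.
have st : (size t <= 2 * n)%N by rewrite (perm_size ts).
(* Default value for the groups that contain no element of [t]: any point
   other than [A]. *)
pose x0 := A + pt 1 0.
have x0A : x0 != A.
  rewrite -subr_eq0 /x0 addrAC subrr add0r; apply/eqP => /rowP/(_ 0)/eqP.
  by rewrite !mxE oner_eq0.
pose P i := nth x0 t i.
pose Q i := if (i + n < size t)%N then nth x0 t (i + n) else P i.
have /fin_all_exists[f fP] : forall i : 'I_n, exists l,
    [/\ is_line l, eval_at l A != 0, eval_at l (P i) = 0 & eval_at l (Q i) = 0].
  move=> i; apply: exists_line_avoiding.
    by rewrite /P; case: (ltnP i (size t)) => h; [apply/At/mem_nth | rewrite nth_default].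
  rewrite /Q; case: ifP => h; last by left.
  by right; split; [apply: tP | apply/At/mem_nth].
exists (codom f); split; first by rewrite size_codom card_ord.
- by move=> _ /codomP[i ->]; case: (fP i).
- by move=> _ /codomP[i ->]; case: (fP i).
move=> B; rewrite -(perm_mem ts) => /(nthP x0)[j jt <-].
have [jn|nj] := ltnP j n.
  by exists (f (Ordinal jn)); [apply: codom_f | case: (fP (Ordinal jn))].
have jn : (j - n < n)%N by rewrite ltn_subLR // addnn -mul2n; apply: leq_trans jt st.
exists (f (Ordinal jn)); first exact: codom_f.
by case: (fP (Ordinal jn)) => _ _ _; rewrite /Q /= subnK // jt.
Qed.

Lemma exists_fundamental_product n X A :
  (1 <= n)%N -> (#|` X `\ A| <= 2 * n)%N ->
  (forall k, count (fun B => slope A B == k) (X `\ A) <= n)%N ->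
  exists p, fundamental n X A p /\ is_product_of_lines p.
Proof.
move=> n1 sX bound.
have [|ls [sls lsl lsA lsX]] := exists_lines_covering sX _ bound.
  by rewrite !inE eqxx.
pose p := \prod_(l <- ls) l.
have pA : eval_at p A != 0.
  rewrite eval_at_prod prodf_seq_neq0; apply/allP => l lls; exact: lsA.
exists ((eval_at p A)^-1 *: p); split.
  apply: fundamental_scale => //.
    by rewrite -sls; apply: in_Pi_prod => l /lsl; rewrite /in_Pi => ->.
  move=> B /lsX[l lls lB]; apply/eqP; rewrite eval_at_prod prodf_seq_eq0.
  by apply/hasP; exists l => //; rewrite /= lB.
exists (eval_at p A)^-1, ls; split => //; first by rewrite invr_eq0.
by rewrite -size_eq0 sls -lt0n.
Qed.

(** * Extending an independent set *)

(** A polynomial that is fundamental for [Z] only is corrected at each new node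
    [B] by a multiple of the fundamental polynomial of [B], which does not
    disturb its values on [Z]. *)
Lemma independent_extend n Z X :
  Z `<=` X -> independent n Z ->
  (forall B, B \in X `\` Z -> exists p, fundamental n X B p) ->
  independent n X.
Proof.
move=> ZX indZ fX C CX; have [CZ|CZ] := boolP (C \in Z); last first.
  by apply: fX; rewrite inE CZ.
have [p [pn pC pZ]] := indZ C CZ.
have /fin_all_exists[f fP] : forall B : X `\` Z, exists q, fundamental n X (val B) q.
  by move=> B; apply: fX; apply: valP.
pose r := \sum_(B : X `\` Z) eval_at p (val B) *: f B.
have evr D : eval_at r D = \sum_(B : X `\` Z) eval_at p (val B) * eval_at (f B) D.
  by rewrite /eval_at /r raddf_sum; apply: eq_bigr => B _; rewrite /= mevalZ.
have rZ D : D \in Z -> eval_at r D = 0.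
  move=> DZ; rewrite evr big1 // => B _; case: (fP B) => _ _ ->; rewrite ?mulr0 //.
  rewrite !inE (fsubsetP ZX) // andbT; apply: contraTneq DZ => ->.
  by have := valP B; rewrite inE => /andP[].
exists (p - r); split.
- apply: in_PiB => //; rewrite /r; apply: (big_ind (in_Pi n)).
  + by rewrite -mpolyC0; apply: in_PiC.
  + exact: in_PiD.
  + by move=> B _; apply: in_PiZ; case: (fP B).
- by rewrite /eval_at mevalB -/(eval_at p C) pC -/(eval_at r C) rZ // subr0.
move=> D /fsetD1P[DC DX]; rewrite /eval_at mevalB -/(eval_at p D) -/(eval_at r D).
have [DZ|DZ] := boolP (D \in Z); first by rewrite rZ // pZ ?subr0 // !inE DC.
have DXZ : D \in X `\` Z by rewrite inE DZ.
rewrite evr (bigD1 [` DXZ]) //= big1 ?addr0 => [|B BD].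
  by case: (fP [` DXZ]) => _ /= -> _; rewrite mulr1 subrr.
case: (fP B) => _ _ ->; rewrite ?mulr0 // !inE DX andbT.
by apply: contraNneq BD => e; apply/eqP/val_inj.
Qed.

(** * Nodes on a parabola *)

Definition parabola_pt (x : R) := pt x (x ^+ 2).

Definition parabola : {mpoly R[2]} := 'X_1 - 'X_0 * 'X_0.

Lemma eval_parabola x y : eval_at parabola (pt x y) = y - x ^+ 2.
Proof. by rewrite /eval_at /parabola !eval_atE expr2. Qed.

Lemma in_Pi_parabola : in_Pi 2 parabola.
Proof.
apply: in_PiB; first by apply: in_PiW (in_PiX _).
by apply: (@in_PiM 1 1); apply: in_PiX.
Qed.

Definition parabola_curve (i : 'I_2) : {poly R} := if i == 0 then 'X else 'X ^+ 2.

Lemma horner_parabola_curve p x :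
  (along parabola_curve p).[x] = eval_at p (parabola_pt x).
Proof.
rewrite horner_along; apply: meval_eq => i; rewrite /parabola_curve mxE.
by case: ifP => _; rewrite !hornerE.
Qed.

Lemma affineE l : in_Pi 1 l ->
  l = (l@_0)%:MP + l@_U_(0) *: 'X_0 + l@_U_(1) *: 'X_1.
Proof.
rewrite /in_Pi => l1; apply/mpolyP => m.
rewrite !mcoeffD !mcoeffZ !mcoeffC !mcoeffX.
have [m0|m2|/eqP/mdeg1P[i /eqP ->]] := ltngtP (mdeg m) 1.
- have /eqP -> : m == 0%MM by rewrite -mdeg_eq0 -leqn0 -ltnS.
  by rewrite eqxx !mnm1_eq0 !mulr0 !addr0 mulr1.
- rewrite memN_msupp_eq0; last by apply: msize_mdeg_ge; apply: leq_trans m2.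
  have neq m' : (mdeg m' <= 1)%N -> (m' == m) = false.
    by move=> h; apply: contraTF m2 => /eqP <-; rewrite -leqNgt.
  by rewrite [m == _]eq_sym !neq ?mdeg0 ?mdeg1 // !mulr0 !addr0.
rewrite mnm1_eq0 mulr0 add0r !eq_mnm1.
case: i => [[|[|i]] hi] //=.
  by rewrite (_ : Ordinal hi = 0) ?eqxx ?mulr1 ?mulr0 ?addr0 //; apply: val_inj.
by rewrite (_ : Ordinal hi = 1) ?eqxx ?mulr1 ?mulr0 ?add0r //; apply: val_inj.
Qed.

(** The three coefficients of a line are those of its restriction
    [c0 + c1 x + c2 x^2], so they are recovered from its values at 0, 1, -1. *)
Lemma along_parabola_neq0 l : is_line l -> along parabola_curve l != 0.
Proof.
move=> ll; have l1 : in_Pi 1 l by rewrite /in_Pi ll.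
apply: contra_eq_neq ll => e.
have ev x : l@_0 + l@_U_(0) * x + l@_U_(1) * x ^+ 2 = 0.
  have := horner_parabola_curve l x; rewrite e horner0 => ->.
  by rewrite [in RHS](affineE l1) /eval_at !eval_atE.
have := ev 0; have := ev 1; have := ev (-1) => h1 h2 h3.
have e0 : l@_0 = 0 by lra.
have e1 : l@_U_(0) = 0 by lra.
have e2 : l@_U_(1) = 0 by lra.
by rewrite (affineE l1) e0 e1 e2 !scale0r !addr0 mpolyC0 msize0.
Qed.

(** A product of lines does not vanish identically on the parabola, and its
    restriction has degree at most [2n]. *)
Lemma product_of_lines_parabola_roots n p (xs : seq R) :
  in_Pi n p -> is_product_of_lines p -> uniq xs ->
  (forall x, x \in xs -> eval_at p (parabola_pt x) = 0) -> (size xs <= 2 * n)%N.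
Proof.
move=> pn [c [ls [c0 _ lsl ep]]] uxs xs0.
have nz : along parabola_curve p != 0.
  rewrite ep along_scale_prod mulf_neq0 ?polyC_eq0 // prodf_seq_neq0.
  by apply/allP => l /lsl /along_parabola_neq0.
have rt : all (root (along parabola_curve p)) xs.
  by apply/allP => x /xs0 e; rewrite rootE horner_parabola_curve e.
rewrite -ltnS; apply: leq_trans (max_poly_roots nz rt uxs) _.
apply: leq_trans (size_along _ (d := 2) _) _ => [i|].
  by rewrite /parabola_curve; case: ifP; rewrite ?size_polyX ?size_polyXn.
by move: pn; rewrite /in_Pi; case: (msize p) => [|d]; lia.
Qed.

(** The chord joining the points of abscissas [a] and [d] has slope [a + d], so
    a line through a node contains at most one other node. *)
Lemma parabola_independent n (xs : seq R) :
  (1 <= n)%N -> (size xs <= 2 * n + 1)%N ->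
  independent n [fset P in map parabola_pt xs].
Proof.
move=> n1 sxs A; set Z := [fset P in _] => AZ.
suff [p [fp _]] : exists p, fundamental n Z A p /\ is_product_of_lines p.
  by exists p.
apply: exists_fundamental_product => //.
  have : (#|` Z| <= size xs)%N by rewrite card_fseq -(size_map parabola_pt) size_undup.
  by rewrite (cardfsD1 A Z) AZ; lia.
move=> k; apply: leq_trans n1.
have slopeZ B C : B \in Z `\ A -> C \in Z `\ A -> slope A B = slope A C -> B = C.
  move: AZ; rewrite !inE => /mapP[a _ ->].
  move=> /andP[neB /mapP[b _ eB]] /andP[neC /mapP[c _ eC]]; subst B C.
  have ba : b != a by apply: contraNneq neB => ->.
  have ca : c != a by apply: contraNneq neC => ->.
  have sl d : d != a -> slope (parabola_pt a) (parabola_pt d) = Some (d + a).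
    move=> da; rewrite /slope !pt0 !pt1 (negPf da); congr Some.
    by field; rewrite subr_eq0.
  by rewrite !sl // => -[/addIr ->].
rewrite -(count_map (slope A) (pred1 k)) count_uniq_mem ?leq_b1 //.
by rewrite map_inj_in_uniq ?fset_uniq.
Qed.

(** * A triangular grid below the parabola *)

(** The grid point of index [(i, j)] is [(i, -(j + 1))]: the shift keeps every
    ordinate negative, hence every grid point off the parabola. *)
Definition lattice_pt (ij : nat * nat) := pt ij.1%:R (- ij.2.+1%:R).

(** The other points of index sum at most [m] are those with smaller first
    index, those with smaller second index, and those with larger index sum;
    the three families of parallel grid lines pass through them. On a grid
    point, [x - y - 1] is the sum of the indices. *)
Definition lattice_lines (m : nat) (ij : nat * nat) : seq {mpoly R[2]} :=
  [seq 'X_0 - a%:R%:MP | a <- iota 0 ij.1]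
  ++ [seq 'X_1 + b.+1%:R%:MP | b <- iota 0 ij.2]
  ++ [seq 'X_0 - 'X_1 - c.+1%:R%:MP | c <- iota (ij.1 + ij.2).+1 (m - (ij.1 + ij.2))].

Lemma in_Pi_lattice_lines m ij : (ij.1 + ij.2 <= m)%N ->
  in_Pi m (\prod_(l <- lattice_lines m ij) l).
Proof.
move=> le_m; have sz : size (lattice_lines m ij) = m.
  by rewrite /lattice_lines !size_cat !size_map !size_iota; lia.
rewrite -[X in in_Pi X]sz; apply: in_Pi_prod => l; rewrite !mem_cat => /or3P[] /mapP[a _ ->].
- by apply: in_PiB; [apply: in_PiX | apply: in_PiC].
- by apply: in_PiD; [apply: in_PiX | apply: in_PiC].
by apply: in_PiB; [apply: in_PiB; apply: in_PiX | apply: in_PiC].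
Qed.

Lemma eval_lattice_lines m ij kl : (ij.1 + ij.2 <= m)%N -> (kl.1 + kl.2 <= m)%N ->
  (eval_at (\prod_(l <- lattice_lines m ij) l) (lattice_pt kl) == 0) = (kl != ij).
Proof.
case: ij kl => i j [k l] /= ijm klm.
have natE (a b : nat) : (a%:R - b%:R == 0 :> R) = (a == b) by rewrite subr_eq0 eqr_nat.
have e0 a : eval_at ('X_0 - a%:R%:MP) (lattice_pt (k, l)) == 0 = (k == a).
  by rewrite /eval_at !eval_atE natE.
have e1 b : eval_at ('X_1 + b.+1%:R%:MP) (lattice_pt (k, l)) == 0 = (l == b).
  by rewrite /eval_at !eval_atE addrC natE eqSS eq_sym.
have e2 c : eval_at ('X_0 - 'X_1 - c.+1%:R%:MP) (lattice_pt (k, l)) == 0 = (k + l == c)%N.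
  by rewrite /eval_at !eval_atE opprK -natrD natE addnS eqSS.
rewrite eval_at_prod prodf_seq_eq0 /= /lattice_lines !has_cat !has_map /=.
rewrite (@eq_has _ _ (pred1 k)) => [|a]; last by rewrite /= e0 eq_sym.
rewrite (@eq_has _ (preim _ _) (pred1 l)) => [|b]; last by rewrite /= e1 eq_sym.
rewrite (@eq_has _ (preim _ _) (pred1 (k + l)%N)) => [|c]; last by rewrite /= e2 eq_sym.
rewrite !has_pred1 !mem_iota xpair_eqE.
by apply/idP/idP; lia.
Qed.

Definition triangle (m : nat) : seq (nat * nat) :=
  [seq (i, j) | i <- iota 0 m.+1, j <- iota 0 (m.+1 - i)].

Lemma mem_triangle m ij : ij \in triangle m -> (ij.1 + ij.2 <= m)%N.
Proof.
by case/allpairsPdep => i [j []]; rewrite !mem_iota => hi hj -> /=; lia.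
Qed.

Lemma uniq_triangle m : uniq (triangle m).
Proof.
apply: allpairs_uniq_dep => [|i _|]; rewrite ?iota_uniq //.
by move=> [i j] [k l] _ _ /= [-> ->].
Qed.

Lemma size_triangle m : size (triangle m) = 'C(m.+2, 2).
Proof.
rewrite size_allpairs_dep sumnE big_map.
rewrite -[iota 0 m.+1]/(index_iota 0 m.+1) big_nat_rev -bin2_sum [RHS]big_nat_recl //.
rewrite add0n [LHS]big_nat [RHS]big_nat; apply: eq_bigr => i /=.
by rewrite size_iota; lia.
Qed.

(** * Sets with a node without fundamental product of lines *)

Lemma exists_node_without_line_product n s :
  (2 <= n)%N -> (2 * n + 2 <= s)%N -> (s <= 'C(n + 2, 2))%N ->
  exists X A,
    [/\ independent n X, #|` X| = s, A \in X
      & forall p, fundamental n X A p -> ~ is_product_of_lines p].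
Proof.
move=> n2 les leC.
pose xs : seq R := [seq k%:R | k <- iota 0 (2 * n + 1)].
pose ijs := take (s - (2 * n + 1)) (triangle (n - 2)).
have uxs : uniq xs by rewrite map_inj_uniq ?iota_uniq //; apply: mulrIn; apply: oner_neq0.
have sxs : size xs = (2 * n + 1)%N by rewrite size_map size_iota.
have uij : uniq ijs by apply: take_uniq; apply: uniq_triangle.
have sij : size ijs = (s - (2 * n + 1))%N.
  rewrite size_takel // size_triangle.
  have -> : (n - 2).+2 = n by lia.
  by move: leC; rewrite addn2 !binS !bin1 bin0; lia.
have leij ij : ij \in ijs -> (ij.1 + ij.2 <= n - 2)%N.
  by move=> /mem_take /mem_triangle.
pose Z := [fset P in map parabola_pt xs].
pose Y := [fset P in map lattice_pt ijs].
have parZ P : P \in Z -> eval_at parabola P = 0.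
  by rewrite inE => /mapP[x _ ->]; rewrite eval_parabola subrr.
have parY P : P \in Y -> eval_at parabola P != 0.
  rewrite inE => /mapP[ij _ ->]; rewrite eval_parabola lt_eqF //.
  have := sqr_ge0 (ij.1%:R : R); have : (0 : R) < ij.2.+1%:R by rewrite ltr0n.
  by lra.
have injZ : injective parabola_pt.
  by move=> x y e; rewrite -(pt0 x (x ^+ 2)) -/(parabola_pt x) e pt0.
have injY : injective lattice_pt.
  move=> [i j] [k l] e.
  have /eqP := congr1 (fun P : 'rV[R]_2 => P 0 0) e.
  have /eqP := congr1 (fun P : 'rV[R]_2 => P 0 1) e.
  by rewrite !pt0 !pt1 eqr_opp !eqr_nat eqSS => /eqP /= -> /eqP ->.
have cZ : #|` Z| = (2 * n + 1)%N.
  by rewrite card_fseq undup_id ?size_map ?size_iota // map_inj_uniq.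
have cY : #|` Y| = (s - (2 * n + 1))%N.
  by rewrite card_fseq undup_id ?size_map // map_inj_uniq.
have disj : [disjoint Z & Y].
  by apply/fdisjointP => P /parZ PZ; apply/negP => /parY; rewrite PZ eqxx.
have [A AY] : exists A, A \in Y by apply/fset0Pn; rewrite -cardfs_gt0 cY; lia.
exists (Z `|` Y), A; split.
- apply: (@independent_extend n Z); first exact: fsubsetUl.
    by apply: parabola_independent; lia.
  move=> B; rewrite fsetDUl fsetDv fset0U => /fsetDP[BY _].
  move: (BY); rewrite inE => /mapP[ij ijin eB].
  pose p := parabola * \prod_(l <- lattice_lines (n - 2) ij) l.
  exists ((eval_at p B)^-1 *: p); apply: fundamental_scale.
  + have -> : n = (2 + (n - 2))%N by lia.
    by apply: in_PiM in_Pi_parabola (in_Pi_lattice_lines (leij _ ijin)).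
  + by rewrite eval_atM mulf_neq0 ?parY // eB eval_lattice_lines ?leij // eqxx.
  move=> C /fsetD1P[CB /fsetUP[/parZ CZ|]]; first by rewrite eval_atM CZ mul0r.
  rewrite inE => /mapP[kl klin eC]; rewrite eval_atM eC.
  have /eqP -> : eval_at (\prod_(l <- lattice_lines (n - 2) ij) l) (lattice_pt kl) == 0.
    by rewrite eval_lattice_lines ?leij //; apply: contraNneq CB => e; rewrite eC eB e.
  by rewrite mulr0.
- by rewrite cardfsU (disjoint_fsetI0 disj) cardfs0 cZ cY; lia.
- by rewrite inE AY orbT.
move=> p [pn _ pX] pl.
have := product_of_lines_parabola_roots pn pl uxs; rewrite sxs => h.
have : (2 * n + 1 <= 2 * n)%N; last by lia.
apply: h => x xin; apply: pX.
have PZ : parabola_pt x \in Z by rewrite inE map_f.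
apply/fsetD1P; split; last by rewrite in_fsetU PZ.
by apply: contraTneq AY => <-; apply/negP => /parY; rewrite parZ ?eqxx.
Qed.

End Plane.

Theorem theorem2p1 (R : realType) :
  (forall (n : nat) (X : {fset 'rV[R]_2}),
      (1 <= n)%N -> independent n X -> (#|` X| <= 2 * n + 1)%N ->
      forall A, A \in X ->
        exists p : {mpoly R[2]}, fundamental n X A p /\ is_product_of_lines p)
  /\
  (forall n s : nat,
      (2 <= n)%N -> (2 * n + 2 <= s)%N -> (s <= 'C(n + 2, 2))%N ->
      exists (X : {fset 'rV[R]_2}) (A : 'rV[R]_2),
        [/\ independent n X, #|` X| = s, A \in X
          & forall p : {mpoly R[2]},
              fundamental n X A p -> ~ is_product_of_lines p]).
Proof.
split=> [n X n1 indX cX A AX|]; last exact: exists_node_without_line_product.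
apply: exists_fundamental_product => //.
  by move: cX; rewrite (cardfsD1 A X) AX; lia.
move=> k; have [p [pn pA pX]] := indX A AX.
by apply: count_slope_le pn _ (fset_uniq _) pX; rewrite pA oner_neq0.
Qed.
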